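(* Let $X$ be a metric space and let $\alpha$ denote the Kuratowski measure of noncompactness on $X$. Then for every bounded subset $B\subset X$ there is a countable subset $B_0$ of $B$ such that $\alpha(B_0)=\alpha(B)$.
   Context: For a bounded subset $B$ of a metric space $X$, the Kuratowski measure of noncompactness is $$\alpha(B)=\inf\Big\{d>0:\ B\subset\bigcup_{j\in F}E_j \text{ for some finite index set } F \text{ and sets } E_j\subset X \text{ with } \operatorname{diam}(E_j)\le d \text{ for all } j\in F\Big\}.$$ *)

(* Defs.v *)
From mathcomp Require Import all_boot all_order all_algebra.
From mathcomp Require Import boolp classical_sets cardinality reals ereal.
From mathcomp Require Import topology metric_structure.

Set Implicit Arguments.
Unset Strict Implicit.
Unset Printing Implicit Defensive.

Import Order.TTheory GRing.Theory Num.Theory.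

Local Open Scope classical_set_scope.
Local Open Scope ring_scope.

(* The supremum over the empty set is -oo; the maximum makes diam set0 = 0. *)
Definition diam (R : realType) (X : metricType R) (E : set X) : \bar R :=
  Order.max 0%E (ereal_sup [set (mdist x y)%:E | x in E & y in E]).

(* The library's bounded_set is only for normed modules. *)
Definition mbounded (R : realType) (X : metricType R) (B : set X) : Prop :=
  (diam B < +oo)%E.

(* For bounded B the infimum is over a nonempty set of positive reals, hence
   genuine; for unbounded B that set is empty and inf takes the value 0. *)
Definition kuratowski (R : realType) (X : metricType R) (B : set X) : R :=
  inf [set d : R | 0 < d /\
    exists (F : finType) (E : F -> set X),
      (forall j, (diam (E j) <= d%:E)%E) /\ B `<=` \bigcup_j E j].

(* Main.v *)
Require Import Defs.
From mathcomp Require Import all_boot all_order all_algebra.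
From mathcomp Require Import boolp classical_sets cardinality reals ereal.
From mathcomp Require Import topology metric_structure.
From mathcomp Require Import filter.

(** The inequality [kuratowski B0 <= kuratowski B] is monotonicity, so the
    point is to find a countable [B0] inside [B] that is as hard to cover as [B]
    itself.  A cover of a set by finitely many sets of diameter at most [d] is
    the same thing as a colouring of its points with finitely many colours in
    which points of equal colour are at distance at most [d], that is, a proper
    colouring of the graph joining the points at distance more than [d].  By
    the compactness theorem of de Bruijn and Erdos
    ([colorable_of_finite_subsets]), if [B] cannot be coloured in this way with
    [n] colours, then already some finite subset of [B] cannot.

    Take one such finite subset for every number of colours and every rational
    [q]; their union [B0] is countable.  If [B0] can be covered at scale [d] and
    [q > d] is rational, then [B0] can be coloured with some number [n] of
    colours at scale [q], hence so can its subset chosen for [(n, q)], hence so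
    can [B].  Thus [kuratowski B <= q] for every rational [q > d], and so
    [kuratowski B <= kuratowski B0]. *)

Local Open Scope classical_set_scope.
Local Open Scope ring_scope.

Import Order.TTheory GRing.Theory Num.Theory.

(** * Compactness of finite colourings *)

(** The relation [r] is the complement of a graph: [c] is required to be a
    proper colouring on [A] of the graph of the pairs not related by [r].  The
    colouring is total on [T] so that one colour type serves all subsets. *)
Definition colorable (C : finType) (T : Type) (r : T -> T -> Prop)
    (A : set T) : Prop :=
  exists c : T -> C, forall x y, A x -> A y -> c x = c y -> r x y.

Lemma colorable_subset (C : finType) (T : Type) (r : T -> T -> Prop)
    (A A' : set T) :
  A' `<=` A -> colorable C T r A -> colorable C T r A'.
Proof. by move=> sA [c cP]; exists c => x y /sA Ax /sA Ay; exact: cP. Qed.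

Lemma ultra_fibre (T : Type) (C : finType) (U : set_system T) (f : T -> C) :
  UltraFilter U -> exists i, U (f @^-1` [set i]).
Proof.
move=> UU; apply: contrapT => /forallNP noi.
have /filter_ex[t] : U [set t | forall i, f t <> i].
  apply: (@filter_forall _ _ (fun i => [set t | f t <> i]) U _) => i.
  by have [/noi|] := in_ultra_setVsetC (f @^-1` [set i]) UU.
by move=> /(_ (f t)).
Qed.

(** The de Bruijn-Erdos theorem.  Colour every finite subset of [A], and let
    [x] receive the colour that it has in almost all of these colourings, with
    respect to an ultrafilter on the finite subsets of [A] that contains, for
    each finite [S], the collection of those that include [S].  Two points
    of [A] then have their limit colours simultaneously in the colouring of
    some finite subset containing both of them. *)
Lemma colorable_of_finite_subsets (C : finType) (T : Type)
    (r : T -> T -> Prop) (A : set T) :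
  (forall S, finite_set S -> S `<=` A -> colorable C T r S) ->
  colorable C T r A.
Proof.
move=> colA; pose D := [set S | finite_set S /\ S `<=` A].
have /choice[col colP] (S : set T) : exists c : T -> C,
    D S -> forall x y, S x -> S y -> c x = c y -> r x y.
  have [[/colA/[apply][[c cP]]]|nDS] := pselect (D S); first by exists c.
  (* the colouring of the empty set only serves to inhabit [T -> C] *)
  by have [c _] := colA _ (finite_set0 T) (@sub0set _ A); exists c.
pose cone S := [set S' | D S' /\ S `<=` S'].
have coneF : Filter (filter_from D cone).
  apply: filter_from_filter; first by exists set0; split.
  move=> S1 S2 [fS1 sS1] [fS2 sS2]; exists (S1 `|` S2).
    by split; [rewrite finite_setU | rewrite subUset].
  by move=> S' [DS']; rewrite subUset => -[].
have conePF : ProperFilter (filter_from D cone).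
  by apply: filter_from_proper => S DS; exists S; split.
have [U [UU coneU]] := ultraFilterLemma conePF.
have /choice[c cP] : forall x, exists i, U ((col^~ x) @^-1` [set i]).
  by move=> x; exact: ultra_fibre.
exists c => x y Ax Ay cxy.
have Uxy : U (cone [set x; y]).
  apply: coneU; exists [set x; y] => //; split; first exact: finite_set2.
  by move=> z [->|->].
have [S [[/= cSx cSy] [DS xyS]]] :=
  filter_ex (filterI (filterI (cP x) (cP y)) Uxy).
by apply: (colP S DS); [apply: xyS; left | apply: xyS; right |
  rewrite cSx cSy].
Qed.

(** * Covers by small sets as colourings *)

Section Covers.
Variables (R : realType) (X : metricType R).
Implicit Types (A B E : set X) (d : R).

Let close d (x y : X) : Prop := mdist x y <= d.

Lemma diam_leP E d : 0 <= d ->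
  (diam E <= d%:E)%E <-> (forall x y, E x -> E y -> mdist x y <= d).
Proof.
move=> d0; rewrite /diam ge_max lee_fin d0 /=; split => [Ed x y Ex Ey|Ed].
  rewrite -lee_fin; apply: le_trans Ed; apply: ereal_sup_ubound.
  by exists x => //; exists y.
by apply: ge_ereal_sup => _ [x Ex [y Ey <-]]; rewrite lee_fin; exact: Ed.
Qed.

(** The set whose infimum is [kuratowski B]. *)
Definition cover_scales B : set R :=
  [set d : R | 0 < d /\
    exists (F : finType) (E : F -> set X),
      (forall j, (diam (E j) <= d%:E)%E) /\ B `<=` \bigcup_j E j].

(** Numbers of colours of the form [n.+1] suffice: points outside [B] need a
    colour too, and taking it in addition to the indices of the cover also
    accommodates the empty cover. *)
Lemma cover_scalesP B d : 0 < d ->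
  cover_scales B d <-> exists n : nat, colorable 'I_n.+1 X (close d) B.
Proof.
move=> d0; split => [[_ [F [E [Ed BE]]]]|[n [c cP]]].
  have /choice[j jP] (x : X) : exists o : option F,
      B x -> exists2 i, o = Some i & E i x.
    have [/BE[i _ Eix]|nBx] := pselect (B x); last by exists None.
    by exists (Some i) => _; exists i.
  exists #|F|; exists (fun x => cast_ord (card_option F) (enum_rank (j x))).
  move=> x y /jP[i ji Eix] /jP[i' ji' Eiy] /cast_ord_inj/enum_rank_inj.
  rewrite ji ji' => -[ii']; rewrite -ii' in Eiy.
  by have /diam_leP := Ed i; apply => //; exact: ltW.
split=> //; exists 'I_n.+1, (fun i => B `&` c @^-1` [set i]); split=> [i|x Bx].
  by apply/diam_leP => [|x y [Bx /= cx] [By /= cy]];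
    [exact: ltW | apply: cP => //; rewrite cx cy].
by exists (c x).
Qed.

Lemma cover_scales_le B d d' :
  d <= d' -> cover_scales B d -> cover_scales B d'.
Proof.
move=> dd' [d0 [F [E [Ed BE]]]]; split; first exact: lt_le_trans dd'.
by exists F, E; split=> // j; apply: le_trans (Ed j) _; rewrite lee_fin.
Qed.

Lemma cover_scales_subset A B :
  A `<=` B -> cover_scales B `<=` cover_scales A.
Proof.
move=> AB d [d0 [F [E [Ed BE]]]]; split=> //.
by exists F, E; split=> //; exact: subset_trans BE.
Qed.

Lemma cover_scales_lbound B : has_lbound (cover_scales B).
Proof. by exists 0 => d [/ltW]. Qed.

Lemma cover_scales_nonempty B : mbounded B -> cover_scales B !=set0.
Proof.
move=> bB; have dB : diam B \is a fin_num.
  by rewrite ge0_fin_numE // /diam le_max lexx.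
exists (Num.max 1 (fine (diam B))); split; first by rewrite lt_max ltr01.
exists unit, (fun=> B); split=> [_|x Bx]; last by exists tt.
by rewrite -{1}(fineK dB) lee_fin le_max lexx orbT.
Qed.

(** * A countable subset as hard to cover as the whole set *)

(** The subset works for all numbers of colours and all rational scales at
    once, which is what lets it depend neither on the cover nor on the scale. *)
Lemma countable_witness B :
  exists B0, [/\ B0 `<=` B, countable B0 & forall (n : nat) (q : rat),
    colorable 'I_n.+1 X (close (ratr q)) B0 ->
    colorable 'I_n.+1 X (close (ratr q)) B].
Proof.
have /choice[S SP] (p : nat * rat) : exists S : set X,
    [/\ finite_set S, S `<=` B &
      colorable 'I_p.1.+1 X (close (ratr p.2)) S ->
      colorable 'I_p.1.+1 X (close (ratr p.2)) B].
  apply: contrapT => /forallNP noS.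
  (* Every finite subset of [B] is then colourable, hence so is [B], and the
     empty set has the required property after all. *)
  have colB : colorable 'I_p.1.+1 X (close (ratr p.2)) B.
    apply: colorable_of_finite_subsets => S fS SB.
    by apply: contrapT => ncol; apply: (noS S); split.
  by apply: (noS set0); split.
exists (\bigcup_p S p); split.
- by move=> x [p _]; have [_ + _] := SP p; apply.
- apply: bigcup_countable => // p _.
  by apply: finite_set_countable; have [] := SP p.
- move=> n q colB0; have [_ _] := SP (n, q); apply.
  by apply: colorable_subset colB0; exact: bigcup_sup.
Qed.

End Covers.

Theorem theorem5p3 (R : realType) (X : metricType R) (B : set X) :
  mbounded B ->
  exists B0 : set X,
    [/\ B0 `<=` B, countable B0 & kuratowski B0 = kuratowski B].
Proof.
move=> bB; have [B0 [B0B cB0 B0P]] := countable_witness R X B.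
exists B0; split=> //; apply: le_anti.
have BB0 := cover_scales_subset _ _ _ _ B0B.
have [d0 Bd0] := cover_scales_nonempty _ _ _ bB.
apply/andP; split.
  apply: lb_le_inf; first by exists d0.
  by move=> d /BB0; apply: ge_inf; exact: cover_scales_lbound.
apply: lb_le_inf; first by exists d0; exact: BB0.
move=> d B0d; rewrite leNgt; apply/negP => /rat_in_itvoo[q].
rewrite in_itv /= => /andP[dq]; apply/negP; rewrite -leNgt.
have q0 : 0 < ratr q :> R by case: B0d => /lt_trans + _; exact.
apply: ge_inf; first exact: cover_scales_lbound.
have /cover_scalesP[//|n /B0P colB] := cover_scales_le _ _ _ _ _ (ltW dq) B0d.
by apply/(cover_scalesP _ _ _ _ q0); exists n.
Qed.
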